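(* An isolate-free graph $G$ is $\gamma_{tg}$-perfect if and only if it is $(P_4,\overline{2P_3})$-free, i.e. $G$ contains neither the path $P_4$ nor the complement $\overline{2P_3}$ of the disjoint union of two paths $P_3$ as an induced subgraph.
   Context: Graphs are finite, simple, undirected, with at least one vertex, not necessarily connected. $P_n$ is the path on $n$ vertices. A graph is isolate-free if it has no vertex of degree $0$. A vertex totally dominates its neighbors (not itself). For an isolate-free graph $G$, $\gamma_t(G)$ is the total domination number, i.e. the minimum size of a set $S\subseteq V(G)$ such that every vertex of $G$ has a neighbor in $S$. Total domination game on an isolate-free graph $G$: Dominator and Staller alternately select vertices; each selected vertex must totally dominate at least one vertex not totally dominated by the previously selected vertices. The game ends when no legal move exists. Dominator wants to minimize and Staller to maximize the total number of moves. $\gamma_{tg}(G)$ is the number of moves under optimal play when Dominator starts. $G$ is $\gamma_{tg}$-perfect if every isolate-free induced subgraph $F$ of $G$ satisfies $\gamma_{tg}(F)=\gamma_t(F)$. *)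

(* Defs.v *)
From mathcomp Require Import all_boot.

Set Implicit Arguments.
Unset Strict Implicit.
Unset Printing Implicit Defensive.

Record sgraph := SGraph {
  vertex :> finType;
  edge : rel vertex;
  edge_sym : symmetric edge;
  edge_irrefl : irreflexive edge }.

Section Constructions.

Definition path_edge n : rel 'I_n := fun i j => (i.+1 == j) || (j.+1 == i).

Fact path_edge_sym n : symmetric (@path_edge n).
Proof. by move=> i j; rewrite /path_edge orbC. Qed.

Fact path_edge_irrefl n : irreflexive (@path_edge n).
Proof. by move=> i; rewrite /path_edge orbb eqn_leq ltnn. Qed.

Definition path_graph n := SGraph (@path_edge_sym n) (@path_edge_irrefl n).

Variables G H : sgraph.

Definition union_edge : rel (G + H)%type := fun x y =>
  match x, y with
  | inl a, inl b => edge a b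
  | inr a, inr b => edge a b
  | _, _ => false
  end.

Fact union_edge_sym : symmetric union_edge.
Proof. by case=> a [] b //=; apply: edge_sym. Qed.

Fact union_edge_irrefl : irreflexive union_edge.
Proof. by case=> a /=; apply: edge_irrefl. Qed.

Definition disjoint_union := SGraph union_edge_sym union_edge_irrefl.

Definition compl_edge : rel G := fun x y => (x != y) && ~~ edge x y.

Fact compl_edge_sym : symmetric compl_edge.
Proof. by move=> x y; rewrite /compl_edge eq_sym edge_sym. Qed.

Fact compl_edge_irrefl : irreflexive compl_edge.
Proof. by move=> x; rewrite /compl_edge eqxx. Qed.

Definition complement := SGraph compl_edge_sym compl_edge_irrefl.

Variable A : {set G}.

Definition induced_edge : rel {x : G | x \in A} :=
  fun x y => edge (val x) (val y).

Fact induced_edge_sym : symmetric induced_edge.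
Proof. by move=> x y; apply: edge_sym. Qed.

Fact induced_edge_irrefl : irreflexive induced_edge.
Proof. by move=> x; apply: edge_irrefl. Qed.

Definition induced := SGraph induced_edge_sym induced_edge_irrefl.

End Constructions.

Definition isomorphic (G H : sgraph) : Prop :=
  exists2 f : G -> H, bijective f & {mono f : x y / edge x y}.

Definition induced_free (H G : sgraph) : Prop :=
  ~ exists A : {set G}, isomorphic H (induced A).

Section TotalDomination.

Variable G : sgraph.

Definition isolate_free : bool := [forall x : G, exists y : G, edge x y].

Definition neighbors (x : G) : {set G} := [set y | edge x y].

Definition total_dominating (S : {set G}) : bool :=
  [forall x : G, exists y in S, edge x y].

(* The whole vertex set is total dominating exactly when G is isolate-free,
   so the minimum below is meaningful for isolate-free G only. *)
Definition total_domination_number : nat :=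
  #|[arg min_(S < [set: G] | total_dominating S) #|S|]|.

(* A position of the game is the set S of vertices selected so far; a selected
   vertex is never legal again, as it totally dominates nothing new. *)
Definition totally_dominated (S : {set G}) : {set G} :=
  \bigcup_(x in S) neighbors x.

Definition legal (S : {set G}) (x : G) : bool :=
  ~~ (neighbors x \subset totally_dominated S).

(* Number of moves played from position S under optimal play, truncated at
   [fuel] moves; [dom] tells whether Dominator is to move. *)
Fixpoint moves_left (fuel : nat) (dom : bool) (S : {set G}) : nat :=
  if fuel is fuel'.+1 then
    let after x := moves_left fuel' (~~ dom) (x |: S) in
    if [pick x | legal S x] is Some x0 then
      (if dom then after [arg min_(x < x0 | legal S x) after x]
              else after [arg max_(x > x0 | legal S x) after x]).+1
    else 0
  else 0.

(* Every move totally dominates a new vertex, so no play exceeds #|G| moves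
   and the truncation is never reached. *)
Definition game_total_domination_number : nat := moves_left #|G| true set0.

End TotalDomination.

Definition game_perfect (G : sgraph) : Prop :=
  forall A : {set G}, A != set0 -> isolate_free (induced A) ->
    game_total_domination_number (induced A)
    = total_domination_number (induced A).

(* Main.v *)
(* A component of a [P_4]-free graph has diameter at most two, and each of its
   vertices lies on an edge that dominates the component and whose ends lie in
   different components of the complement.  If the graph has no induced
   complement of [2P_3] either, then some vertex [x] of the component is such
   that all non-neighbors of [x] there have the same neighborhood.  Dominator
   opens a component with such an [x], so that the next move in it finishes it,
   and answers Staller's opening at [y] with the other end of a dominating edge
   at [y].  Thus each component takes exactly two moves, as many vertices as a
   total dominating set needs.  Conversely, both forbidden graphs have total
   domination number two, but after any first move Staller has a reply that
   does not complete a total dominating set. *)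
Require Import Defs.
From mathcomp Require Import all_boot.

Set Implicit Arguments.
Unset Strict Implicit.
Unset Printing Implicit Defensive.

(** * Positions of the game and total dominating sets *)

Lemma in_totally_dominated (G : sgraph) (S : {set G}) (u : G) :
  (u \in totally_dominated S) = [exists s in S, edge s u].
Proof.
apply/bigcupP/exists_inP => -[s sS]; first by rewrite inE; exists s.
by move=> su; exists s; rewrite ?inE.
Qed.

Lemma in_totally_dominatedU1 (G : sgraph) (S : {set G}) (x u : G) :
  (u \in totally_dominated (x |: S)) = edge x u || (u \in totally_dominated S).
Proof.
rewrite !in_totally_dominated; apply/exists_inP/orP.
  case=> s /setU1P[-> | sS] su; first by left.
  by right; apply/exists_inP; exists s.
case=> [xu | /exists_inP[s sS su]]; first by exists x; rewrite ?setU11.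
by exists s; rewrite // setU1r.
Qed.

Lemma legalP (G : sgraph) (S : {set G}) (x : G) :
  reflect (exists2 u, edge x u & u \notin totally_dominated S) (legal S x).
Proof.
apply: (iffP subsetPn) => -[u]; first by rewrite inE; exists u.
by move=> xu; exists u; rewrite ?inE.
Qed.

Lemma moves_left_no_legal (G : sgraph) n dom (S : {set G}) :
  (forall x, ~~ legal S x) -> moves_left n dom S = 0.
Proof.
case: n => //= n noS; case: pickP => // x Sx.
by rewrite (negPf (noS x)) in Sx.
Qed.

Lemma moves_left_attained (G : sgraph) n dom (S : {set G}) (x : G) :
  legal S x -> exists2 y, legal S y
    & moves_left n.+1 dom S = (moves_left n (~~ dom) (y |: S)).+1.
Proof.
move=> Sx /=; case: pickP => [x0 Sx0 | /(_ x)]; last by rewrite Sx.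
case: dom; first by case: arg_minnP => // y Sy _; exists y.
by case: arg_maxnP => // y Sy _; exists y.
Qed.

Lemma moves_left_dominator (G : sgraph) n (S : {set G}) (x : G) :
  legal S x -> moves_left n.+1 true S <= (moves_left n false (x |: S)).+1.
Proof.
move=> Sx /=; case: pickP => [x0 Sx0 | //].
by case: arg_minnP => // y _ /(_ x Sx).
Qed.

Lemma moves_left_staller (G : sgraph) n (S : {set G}) (x : G) :
  legal S x -> (moves_left n true (x |: S)).+1 <= moves_left n.+1 false S.
Proof.
move=> Sx /=; case: pickP => [x0 Sx0 | /(_ x)]; last by rewrite Sx.
by case: arg_maxnP => // y _ /(_ x Sx).
Qed.

Lemma total_dominatingE (G : sgraph) (S : {set G}) :
  total_dominating S = [forall u, u \in totally_dominated S].
Proof.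
apply: eq_forallb => u; rewrite in_totally_dominated.
by apply: eq_existsb => s; rewrite edge_sym.
Qed.

Lemma total_dominatingT (G : sgraph) :
  isolate_free G -> total_dominating [set: G].
Proof.
move/forallP=> isoG; apply/forallP=> u; have /existsP[v uv] := isoG u.
by apply/exists_inP; exists v.
Qed.

Lemma total_domination_number_le (G : sgraph) (S : {set G}) :
  total_dominating S -> total_domination_number G <= #|S|.
Proof.
move=> domS; rewrite /total_domination_number.
(* [arg_minnP] needs the default value [[set: G]] to be total dominating itself. *)
have domT : total_dominating [set: G].
  apply/forallP=> u; have /exists_inP[s _ us] := forallP domS u.
  by apply/exists_inP; exists s.
by case: arg_minnP => // T _ /(_ S domS).
Qed.

Lemma total_domination_number_ge (G : sgraph) k : isolate_free G ->
  (forall S : {set G}, total_dominating S -> k <= #|S|) ->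
  k <= total_domination_number G.
Proof.
move=> isoG minS; rewrite /total_domination_number.
by case: arg_minnP => [|S /minS //]; apply: total_dominatingT.
Qed.

(** Each legal move shrinks the set of undominated vertices, so fuel [n] lets the play run until no
    move is legal. As no vertex is isolated, the selected set is then total dominating. *)
Lemma total_domination_number_le_play (G : sgraph) n dom (S : {set G}) :
    isolate_free G -> #|~: totally_dominated S| <= n ->
  total_domination_number G <= #|S| + moves_left n dom S.
Proof.
move=> isoG; elim: n dom S => [|n IHn] dom S leSn.
  apply: leq_trans (total_domination_number_le _) (leq_addr _ _).
  rewrite total_dominatingE; apply/forallP=> u.
  move: leSn; rewrite leqn0 cards_eq0 => /eqP/setP/(_ u).
  by rewrite !inE => /negPn.
case: (pickP (legal S)) => [x Sx | noS]; last first.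
  apply: leq_trans (total_domination_number_le _) (leq_addr _ _).
  rewrite total_dominatingE; apply/forallP=> u; apply/negPn/negP=> Su.
  have /existsP[v uv] := forallP isoG u.
  by have /legalP[] := noS v; exists u; rewrite // edge_sym.
have [y Sy ->] := moves_left_attained n dom Sx.
have leU : #|~: totally_dominated (y |: S)| <= n.
  rewrite -ltnS; apply: leq_trans leSn; apply: proper_card.
  apply/properP; split.
    apply/subsetP=> u; rewrite !inE in_totally_dominatedU1.
    by case/norP.
  have /legalP[u yu Su] := Sy; exists u; rewrite ?inE //.
  by rewrite in_totally_dominatedU1 yu.
apply: leq_trans (IHn (~~ dom) _ leU) _; rewrite addnS -addSn leq_add2r.
by rewrite cardsU1; case: (y \notin S).
Qed.

Lemma game_total_domination_number_ge (G : sgraph) : isolate_free G ->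
  total_domination_number G <= game_total_domination_number G.
Proof.
move=> isoG; rewrite -[leqRHS]add0n -(cards0 G).
exact: total_domination_number_le_play (max_card _).
Qed.

(** * Relations without an induced path on four vertices *)

(* The four vertices are automatically distinct when [e] is symmetric. *)
Definition p4_free (T : Type) (e : rel T) : Prop := forall a b c d,
  e a b -> e b c -> e c d -> ~~ e a c -> ~~ e b d -> ~~ e a d -> False.

(** Distance at most two; for a symmetric [p4_free] relation this is lying in the same component. *)
Definition near (T : finType) (e : rel T) : rel T :=
  fun u v => [|| u == v, e u v | [exists z, e u z && e z v]].

(** A walk [u], [z], [v], [w] that cannot be shortened would be an induced path. *)
Lemma near_step (T : finType) (e : rel T) (u v w : T) :
  symmetric e -> p4_free e -> near e u v -> e v w -> near e u w.
Proof.
move=> syme p4e /or3P[/eqP-> | uv | /existsP[z /andP[uz zv]]] vw.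
- by rewrite /near vw orbT.
- by apply/or3P/Or33/existsP; exists v; rewrite uv.
case uw: (e u w); first by rewrite /near uw orbT.
apply/or3P/Or33/existsP.
case uv: (e u v); first by exists v; rewrite uv.
exists z; rewrite uz; apply/negPn/negP=> zw.
by apply: (p4e u z v w); rewrite ?uv ?uw.
Qed.

Lemma near_sym (T : finType) (e : rel T) : symmetric e -> symmetric (near e).
Proof.
move=> syme u v; rewrite /near eq_sym syme; congr [|| _, _ | _].
by apply: eq_existsb => z; rewrite andbC syme [e u z]syme.
Qed.

Lemma near_refl (T : finType) (e : rel T) : reflexive (near e).
Proof. by move=> u; rewrite /near eqxx. Qed.

Lemma near_edge (T : finType) (e : rel T) (u v : T) : e u v -> near e u v.
Proof. by rewrite /near => ->; rewrite orbT. Qed.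

Lemma near_trans (T : finType) (e : rel T) :
  symmetric e -> p4_free e -> transitive (near e).
Proof.
move=> syme p4e v u w uv /or3P[/eqP<- // | vw | /existsP[z /andP[vz zw]]].
  exact: near_step syme p4e uv vw.
exact: near_step syme p4e (near_step syme p4e uv vz) zw.
Qed.

(* Among the neighbors of [y], take [x] with the most neighbors outside the
   neighborhood of [y]. *)
Lemma dominating_edge (T : finType) (e : rel T) (y y' : T) :
    symmetric e -> p4_free e -> e y y' ->
  exists2 x, e y x & forall v, near e y v -> e x v || e y v.
Proof.
move=> syme p4e yy'.
case: (arg_maxnP (fun x => #|[set v | e x v && ~~ e y v]|) yy') => x yx maxx.
exists x => // v yv; apply/negPn/negP=> /norP[xv yNv].
case/or3P: yv xv yNv => [/eqP<- | -> // | /existsP[z /andP[yz zv]]] xv yNv.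
  by rewrite syme yx in xv.
(* As [v] counts for [z] but not for [x], maximality of [x] yields a neighbor [u] of [x] that both
   [y] and [z] miss. *)
have [u] : exists u, [&& e x u, ~~ e y u & ~~ e z u].
  apply/existsP; apply: contraT; rewrite negb_exists => /forallP noU.
  have /= := maxx z yz; rewrite leqNgt => /negP[]; apply: proper_card.
  apply/properP; split; last by exists v; rewrite !inE ?zv ?(negPf xv).
  apply/subsetP=> u; rewrite !inE => /andP[xu yu]; rewrite yu andbT.
  by have := noU u; rewrite xu yu /= negbK.
case/and3P=> xu yu zu.
case xz: (e x z); last first.
  by apply: (p4e z y x u); rewrite // syme ?xz.
case uv: (e u v); last first.
  by apply: (p4e v z x u); rewrite // syme ?uv.
apply: (p4e y x u v) => //.
Qed.

Definition co_rel (T : finType) (C : pred T) (e : rel T) : rel T :=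
  fun u v => [&& C u, C v, u != v & ~~ e u v].

Lemma co_rel_sym (T : finType) (C : pred T) (e : rel T) :
  symmetric e -> symmetric (co_rel C e).
Proof. by move=> syme u v; rewrite /co_rel eq_sym syme andbCA. Qed.

(** The path on four vertices is self-complementary: [a], [b], [c], [d] in the complement is [b],
    [d], [a], [c] in [e]. *)
Lemma co_rel_p4_free (T : finType) (C : pred T) (e : rel T) :
  symmetric e -> p4_free e -> p4_free (co_rel C e).
Proof.
move=> syme p4e a b c d; rewrite /co_rel.
case/and4P=> Ca Cb ab /negPf eab /and4P[_ Cc bc /negPf ebc].
case/and4P=> _ Cd cd /negPf ecd; rewrite Ca Cb Cc Cd /= !negb_and !negbK.
case/orP=> [/eqP ac | ac]; first by rewrite ac (negPf cd) ecd.
case/orP=> [/eqP bd | bd]; first by rewrite -bd (negPf ab) eab.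
case/orP=> [/eqP ad | ad]; first by rewrite ad syme ecd in ac.
by apply: (p4e b d a c); rewrite ?ebc // syme ?eab ?ecd.
Qed.

(* Excludes the complement of [2P_3], with [a2] and [b2] the midpoints of the
   two paths; the six vertices are automatically distinct when [e] is symmetric
   and irreflexive. *)
Definition co2p3_free (T : Type) (e : rel T) : Prop := forall a1 a2 a3 b1 b2 b3,
  [/\ e a1 a3, ~~ e a1 a2 & ~~ e a2 a3] ->
  [/\ e b1 b3, ~~ e b1 b2 & ~~ e b2 b3] ->
  [/\ e a1 b1, e a1 b2 & e a1 b3] ->
  [/\ e a2 b1, e a2 b2 & e a2 b3] ->
  [/\ e a3 b1, e a3 b2 & e a3 b3] -> False.

(** A move that dominates one vertex of [A] dominates all of them. *)
Definition twins (T : finType) (e : rel T) (A : {set T}) : bool :=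
  [forall q in A, forall q' in A, forall w, e w q ==> e w q'].

Lemma twinsP (T : finType) (e : rel T) (A : {set T}) :
  reflect {in A &, forall q q' w, e w q -> e w q'} (twins e A).
Proof.
apply: (iffP forall_inP) => twA q.
  move=> q' Aq Aq' w wq.
  by have /forall_inP/(_ q' Aq')/forallP/(_ w)/implyP := twA q Aq; apply.
move=> Aq; apply/forall_inP=> q' Aq'; apply/forallP=> w; apply/implyP.
exact: twA.
Qed.

Lemma twinsS (T : finType) (e : rel T) (A B : {set T}) :
  A \subset B -> twins e B -> twins e A.
Proof.
move=> sAB /twinsP twB; apply/twinsP=> q q' /(subsetP sAB) Bq /(subsetP sAB).
exact: twB.
Qed.

(* In the complement of [e] restricted to [C], a vertex whose closed
   neighborhood is not a full component lies near an induced [P_3]. *)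
Lemma co_p3_near (T : finType) (e : rel T) (C : {set T}) (x : T) :
    symmetric e -> p4_free e -> x \in C ->
    (forall u v, u \in C -> e u v -> v \in C) ->
    ~~ twins e [set q in C | ~~ e x q] ->
  exists a1 a2 a3, [/\ e a1 a3, ~~ e a1 a2 & ~~ e a2 a3]
    /\ {in [:: a1; a2; a3], forall a, a \in C /\ near (co_rel [in C] e) x a}.
Proof.
move=> syme p4e Cx closedC.
have nearN u v : u \in C -> v \in C -> ~~ e u v -> near (co_rel [in C] e) u v.
  move=> Cu Cv uv; case: (eqVneq u v) => [-> | neq_uv]; first exact: near_refl.
  by apply: near_edge; apply/and4P.
have nearT := near_trans (co_rel_sym [in C] syme) (co_rel_p4_free syme p4e).
rewrite negb_forall => /existsP[q]; rewrite negb_imply !inE -andbA.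
case/and3P=> Cq xq; rewrite negb_forall => /existsP[q'].
rewrite negb_imply !inE -andbA => /and3P[Cq' xq'].
rewrite negb_forall => /existsP[w]; rewrite negb_imply => /andP[wq wq'].
have Cw : w \in C by apply: closedC Cq _; rewrite syme.
(* Since [w] separates [q] from [q'], the midpoint of the induced path in the complement is [q'] if
   [w] is adjacent to [x], and [x] otherwise. *)
case xw: (e x w).
  exists x, q', w; split; first by rewrite [e q' w]syme.
  move=> a; rewrite !inE => /or3P[] /eqP->; split=> //.
  - exact: near_refl.
  - exact: nearN.
  - by apply: (nearT q'); apply: nearN; rewrite // syme.
exists w, x, q; split; first by rewrite [e w x]syme xw.
move=> a; rewrite !inE => /or3P[] /eqP->; split=> //.
- by apply: nearN; rewrite // xw.
- exact: near_refl.
- exact: nearN.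
Qed.

(* Of the two ends of a dominating edge, which lie in different components of
   the complement, at least one has a component of the complement that is
   complete. *)
Lemma twin_nonneighbors (T : finType) (e : rel T) (y y' : T) :
    symmetric e -> irreflexive e -> p4_free e -> co2p3_free e -> e y y' ->
  exists2 x, near e y x & twins e [set q | near e y q & ~~ e x q].
Proof.
move=> syme irre p4e co2p3e yy'.
have [x yx domxy] := dominating_edge syme p4e yy'.
pose C := [set q | near e y q].
have closedC u v : u \in C -> e u v -> v \in C.
  by rewrite !inE => yu; apply: near_step.
have CE z : [set q in C | ~~ e z q] = [set q | near e y q & ~~ e z q].
  by apply/setP=> q; rewrite !inE.
have Cy : y \in C by rewrite inE near_refl.
have Cx : x \in C by apply: closedC yx.
case twx: (twins e [set q in C | ~~ e x q]).
  by exists x; rewrite -?CE //; move: Cx; rewrite inE.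
exists y; first exact: near_refl.
rewrite -CE; apply/negPn/negP=> twy.
have [a1 [a2 [a3 [pa Ha]]]] := co_p3_near syme p4e Cx closedC (negbT twx).
have [b1 [b2 [b3 [pb Hb]]]] := co_p3_near syme p4e Cy closedC twy.
pose h := co_rel [in C] e.
have symh : symmetric h by apply: co_rel_sym.
have trh : transitive (near h) by apply: near_trans => //; apply: co_rel_p4_free.
(* A common non-neighbor of [x] and [y] in [C] would contradict [domxy]. *)
have far : ~~ near h x y.
  apply/negP=> /or3P[/eqP xy | /and4P[_ _ _] | /existsP[z]].
  - by rewrite xy irre in yx.
  - by rewrite syme yx.
  case/andP=> /and4P[_ Cz _ xz] /and4P[_ _ _ zy].
  rewrite inE in Cz; have := domxy z Cz.
  by rewrite (negPf xz) syme (negPf zy).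
have cross a b : a \in [:: a1; a2; a3] -> b \in [:: b1; b2; b3] -> e a b.
  move=> /Ha[Ca xa] /Hb[Cb yb]; apply/negPn/negP=> ab; case/negP: far.
  apply: (trh a) => //; apply: (trh b); last by rewrite near_sym.
  case: (eqVneq a b) => [-> | neq_ab]; first exact: near_refl.
  by apply: near_edge; apply/and4P.
by apply: (co2p3e _ _ _ _ _ _ pa pb); split; apply: cross;
  rewrite !inE eqxx ?orbT.
Qed.

(** * Dominator's strategy *)

Definition component (G : sgraph) (u : G) : {set G} :=
  [set v | near (@edge G) u v].

Definition components (G : sgraph) : {set {set G}} :=
  [set component u | u : G].

(* Each component needs two moves when it is untouched, and one when it is
   touched but not yet totally dominated. *)
Definition weight (G : sgraph) (S : {set G}) : nat :=
  \sum_(C in components G)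
     (~~ (C \subset totally_dominated S) + [disjoint C & S]).

(* In each touched component, the next move will finish the component. *)
Definition tame (G : sgraph) (S : {set G}) : Prop := forall u s, s \in S ->
  near (@edge G) u s ->
  twins (@edge G) (component u :\: totally_dominated S).

Lemma totally_dominatedS (G : sgraph) (S T : {set G}) :
  S \subset T -> totally_dominated S \subset totally_dominated T.
Proof.
move=> sST; apply/subsetP=> u; rewrite !in_totally_dominated.
case/exists_inP=> s sS su; apply/exists_inP; exists s => //.
exact: subsetP sS.
Qed.

(** A move never raises the contribution of any component, so a drop in one suffices. *)
Lemma weight_lt (G : sgraph) (S : {set G}) (x u : G) :
    ((~~ (component u \subset totally_dominated (x |: S))
       + [disjoint component u & x |: S])
     < ~~ (component u \subset totally_dominated S)
       + [disjoint component u & S]) ->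
  weight (x |: S) < weight S.
Proof.
move=> ltu; rewrite /weight.
have Cu : component u \in components G by apply: imset_f.
rewrite !(bigD1 (component u) Cu) /= -addSn leq_add //.
apply: leq_sum => C _; apply: leq_add.
  case sub: (C \subset totally_dominated S) => /=; last by case: (~~ _).
  by rewrite (subset_trans sub) // totally_dominatedS ?subsetUr.
case dis: [disjoint C & x |: S] => //.
by rewrite (disjointWr _ dis) // subsetUr.
Qed.

Lemma tameU1 (G : sgraph) (S : {set G}) (x : G) : tame S ->
    (forall u, near (@edge G) u x ->
      twins (@edge G) (component u :\: totally_dominated (x |: S))) ->
  tame (x |: S).
Proof.
move=> tameS twx u s /setU1P[-> | sS us]; first exact: twx.
by apply: twinsS (tameS u s sS us); rewrite setDS // totally_dominatedS ?subsetUr.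
Qed.

Section Strategy.

Variable G : sgraph.
Hypothesis p4G : p4_free (@edge G).

Local Notation near := (near (@edge G)).

Let nearT : transitive near.
Proof. exact: near_trans (@edge_sym G) p4G. Qed.

Let nearS : symmetric near.
Proof. exact: near_sym (@edge_sym G). Qed.

Lemma component_near u v : near u v -> component u = component v.
Proof.
move=> uv; apply/setP=> w; rewrite !inE; apply/idP/idP; apply: nearT => //.
by rewrite nearS.
Qed.

Lemma near_undominated (S : {set G}) u v :
  [disjoint component u & S] -> near u v -> v \notin totally_dominated S.
Proof.
move=> disS uv; rewrite in_totally_dominated; apply/exists_inP=> -[s sS sv].
have/pred0P/(_ s) := disS; rewrite !inE sS andbT.
by rewrite (near_step (@edge_sym G) p4G uv) // edge_sym.
Qed.

(** Opening a component removes its [disjoint] summand; in a touched component, the undominated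
    vertices are twins, so the move finishes it. *)
Lemma weight_legal_lt (S : {set G}) x :
  tame S -> legal S x -> weight (x |: S) < weight S.
Proof.
move=> tameS /legalP[u xu Su]; apply: (@weight_lt _ _ _ x).
have -> : [disjoint component x & x |: S] = false.
  by apply/pred0Pn; exists x; rewrite !inE near_refl eqxx.
have Cu : u \in component x by rewrite inE near_edge.
have -> /= : component x \subset totally_dominated S = false.
  by apply/subsetPn; exists u.
case: (boolP [disjoint component x & S]) => [_ | /pred0Pn[s /andP[]]].
  by case: (~~ _).
rewrite /= inE => xs sS; have /twinsP tw := tameS x s sS xs.
suff -> : component x \subset totally_dominated (x |: S) by [].
apply/subsetP=> v Cv; rewrite in_totally_dominatedU1.
case Sv: (v \in _); rewrite ?orbT // orbF.
by apply: tw xu; rewrite inE ?Su ?Sv.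
Qed.

Lemma tame_touched (S : {set G}) x s : tame S -> legal S x ->
  s \in S -> near x s -> tame (x |: S).
Proof.
move=> tameS /legalP[u xu Su] sS xs; have /twinsP tw := tameS x s sS xs.
apply: tameU1 => // w wx; rewrite (component_near wx).
apply/twinsP=> v v'; rewrite !inE in_totally_dominatedU1.
case/andP=> /norP[xv Sv] Cv.
by case/negP: xv; apply: (tw u); rewrite // !inE ?Su ?Sv //= near_edge.
Qed.

Hypothesis isoG : isolate_free G.
Hypothesis co2p3G : co2p3_free (@edge G).

Lemma dominator_move (S : {set G}) y : tame S -> legal S y ->
  exists2 x, legal S x & tame (x |: S).
Proof.
move=> tameS Sy.
case: (boolP [disjoint component y & S])
    => [disS | /pred0Pn[s /andP[]]]; last first.
  by rewrite /= inE => ys sS; exists y => //; apply: tame_touched ys.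
have /existsP[y' yy'] := forallP isoG y.
have [x yx twx] :=
  twin_nonneighbors (@edge_sym G) (@edge_irrefl G) p4G co2p3G yy'.
exists x.
  have /existsP[z xz] := forallP isoG x.
  apply/legalP; exists z => //; apply: near_undominated disS _.
  exact: near_step (@edge_sym G) p4G yx xz.
apply: tameU1 => // u ux; apply: twinsS twx; apply/subsetP=> v.
rewrite !inE in_totally_dominatedU1 => /andP[/norP[-> _] uv].
by rewrite andbT; apply: nearT uv; apply: nearT yx _; rewrite nearS.
Qed.

(** A component newly opened by Staller need not be tame, so Dominator finishes it at once with the
    other end of a dominating edge at [y]. *)
Lemma dominator_reply (S : {set G}) y : tame S -> legal S y ->
  tame (y |: S) \/ exists x, [/\ legal (y |: S) x, tame (x |: (y |: S))
    & weight (x |: (y |: S)) < weight (y |: S)].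
Proof.
move=> tameS Sy.
case: (boolP [disjoint component y & S])
    => [disS | /pred0Pn[s /andP[]]]; last first.
  by rewrite /= inE => ys sS; left; apply: tame_touched ys.
right.
have /existsP[y' yy'] := forallP isoG y.
have [x yx domxy] := dominating_edge (@edge_sym G) p4G yy'.
have Sy_y : y \notin totally_dominated (y |: S).
  rewrite in_totally_dominatedU1 edge_irrefl /=.
  exact: near_undominated disS (near_refl _ _).
have sub : component y \subset totally_dominated (x |: (y |: S)).
  apply/subsetP=> v; rewrite inE !in_totally_dominatedU1 orbA => /domxy.
  by move=> ->.
exists x; split.
- by apply/legalP; exists y; rewrite // edge_sym.
- move=> u s; rewrite !inE => sS us.
  case: (boolP (near u y)) => [uy | uy].
    rewrite (component_near uy); move: sub; rewrite -setD_eq0 => /eqP->.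
    by apply/twinsP=> q q'; rewrite inE.
  (* Both [x] and [y] lie in the component of [y], so [s] is neither. *)
  have {}sS : s \in S.
    case/or3P: sS => // /eqP s_eq; case/negP: uy; last by rewrite -s_eq.
    by apply: (nearT us); rewrite s_eq nearS near_edge.
  apply: twinsS (tameS u s sS us); rewrite setDS // totally_dominatedS //.
  by rewrite setUA subsetUr.
apply: (@weight_lt _ _ _ y); rewrite sub /=.
have -> : [disjoint component y & x |: (y |: S)] = false.
  by apply/pred0Pn; exists y; rewrite !inE near_refl eqxx orbT.
suff -> : component y \subset totally_dominated (y |: S) = false by [].
by apply/subsetPn; exists y; rewrite // inE near_refl.
Qed.

(** The induction is strong because tameness may be restored only after Staller's move and
    Dominator's reply, two units of fuel later. *)
Lemma moves_left_le_weight n dom (S : {set G}) :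
  tame S -> moves_left n dom S <= weight S.
Proof.
elim/ltn_ind: n dom S => -[|n] IHn dom S tameS //.
case: (pickP (legal S)) => [y0 Sy0 | noS]; last first.
  by rewrite moves_left_no_legal // => x; rewrite noS.
case: dom.
  have [x Sx tamex] := dominator_move tameS Sy0.
  apply: leq_trans (moves_left_dominator n Sx) _.
  exact: leq_ltn_trans (IHn n (ltnSn n) _ _ tamex) (weight_legal_lt tameS Sx).
have [y Sy ->] := moves_left_attained n false Sy0.
have lty := weight_legal_lt tameS Sy.
case: (dominator_reply tameS Sy) => [tamey | [x [Sx tamex ltx]]].
  exact: leq_ltn_trans (IHn n (ltnSn n) _ _ tamey) lty.
apply: leq_trans lty; rewrite ltnS.
case: n => [//|n] in IHn *.
apply: leq_trans (moves_left_dominator n Sx) _.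
by apply: leq_ltn_trans ltx; apply: IHn.
Qed.

Lemma tame_set0 : tame (set0 : {set G}).
Proof. by move=> u s; rewrite inE. Qed.

(* A total dominating set contains a neighbor of each vertex, and a neighbor
   of this neighbor, hence two vertices of each component. *)
Lemma weight_le_total_dominating (D : {set G}) :
  total_dominating D -> weight (set0 : {set G}) <= #|D|.
Proof.
move/forallP=> domD.
have inC s : s \in D -> component s \in components G by rewrite imset_f.
rewrite -sum1_card (partition_big _ _ inC); apply: leq_sum => C /imsetP[u _ ->].
apply: leq_trans (leq_add (leq_b1 _) (leq_b1 _)) _.
have /exists_inP[s Ds us] := domD u; have /exists_inP[s' Ds' ss'] := domD s.
rewrite sum1dep_card; apply: (@leq_trans #|[set s; s']|).
  by rewrite cards2; case: eqP ss' => // ->; rewrite edge_irrefl.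
apply: subset_leq_card; apply/subsetP=> t; rewrite !inE.
rewrite (component_near (near_edge us)).
case/orP=> /eqP->; rewrite ?Ds ?Ds' /= ?eqxx //.
by rewrite (component_near (near_edge ss')).
Qed.

(** The weight of the empty position bounds the length of the game from above and the size of every
    total dominating set from below. *)
Lemma game_total_domination_numberE :
  game_total_domination_number G = total_domination_number G.
Proof.
apply/eqP; rewrite eqn_leq game_total_domination_number_ge // andbT.
apply: total_domination_number_ge => // D /weight_le_total_dominating.
by apply: leq_trans; apply/moves_left_le_weight/tame_set0.
Qed.

End Strategy.

(** * Induced subgraphs *)

Definition embeds (H G : sgraph) : Prop :=
  exists2 f : H -> G, injective f & {mono f : x y / edge x y}.

Lemma induced_freeP (H G : sgraph) : induced_free H G <-> ~ embeds H G.
Proof.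
split=> freeH; apply: contra_not freeH.
  case=> f injf monof; exists [set f x | x : H].
  have fA x : f x \in [set f x | x : H] by rewrite imset_f.
  exists (fun x => exist _ (f x) (fA x)) => //.
  have fK (y : induced [set f x | x : H]) : exists x, f x == val y.
    by case: y => y /= /imsetP[x _ ->]; exists x.
  exists (fun y => xchoose (fK y)) => [x | y].
    by apply: injf; apply/eqP/(xchooseP (fK _)).
  by apply: val_inj; apply/eqP/(xchooseP (fK y)).
case=> A [f bijf monof]; exists (fun x => val (f x)) => [x y /val_inj | x y].
  exact: bij_inj.
by rewrite -monof.
Qed.

Lemma embeds_induced (H G : sgraph) (A : {set G}) :
  embeds H (induced A) -> embeds H G.
Proof.
case=> f injf monof; exists (fun x => val (f x)) => [x y /val_inj/injf // | x y].
by rewrite -monof.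
Qed.

(** Distinct vertices of [H] have distinct neighborhoods, so preserving adjacency both ways already
    forces injectivity. *)
Lemma embeds_twin_free (H G : sgraph) (f : H -> G) :
    (forall x y : H, edge x =1 edge y -> x = y) ->
    {mono f : x y / edge x y} -> embeds H G.
Proof.
move=> twinH monof; exists f => // x y fxy; apply: twinH => z.
by rewrite -!monof fxy.
Qed.

Lemma p4_free_embeds (G : sgraph) :
  ~ embeds (path_graph 4) G -> p4_free (@edge G).
Proof.
move=> noP4 a b c d ab bc cd ac bd ad; apply: noP4.
pose f (i : path_graph 4) := nth a [:: a; b; c; d] i.
have monof : {mono f : x y / edge x y}.
  by do 2![case=> [[|[|[|[|?]]]] ?] //]; rewrite /f /= ?edge_irrefl ?ab ?bc ?cd
    ?(negPf ac) ?(negPf bd) ?(negPf ad) //; rewrite edge_sym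
    ?ab ?bc ?cd ?(negPf ac) ?(negPf bd) ?(negPf ad).
apply: (embeds_twin_free _ monof) => x y eqe; apply: val_inj.
move: (eqe (Ordinal (isT : 0 < 4))) (eqe (Ordinal (isT : 1 < 4)))
  (eqe (Ordinal (isT : 2 < 4))) (eqe (Ordinal (isT : 3 < 4))); move: x y {eqe}.
by do 2![case=> [[|[|[|[|?]]]] ?] //].
Qed.

Notation co2P3 := (complement (disjoint_union (path_graph 3) (path_graph 3))).

Lemma co2p3_free_embeds (G : sgraph) :
  ~ embeds co2P3 G -> co2p3_free (@edge G).
Proof.
move=> no2P3 a1 a2 a3 b1 b2 b3 [a13 /negPf a12 /negPf a23].
move=> [b13 /negPf b12 /negPf b23] [a1b1 a1b2 a1b3] [a2b1 a2b2 a2b3].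
move=> [a3b1 a3b2 a3b3]; apply: no2P3.
pose f (i : co2P3) := match i with
  | inl i => nth a1 [:: a1; a2; a3] i
  | inr i => nth b1 [:: b1; b2; b3] i end.
pose edgeE := (a13, a12, a23, b13, b12, b23,
  (a1b1, a1b2, a1b3, a2b1, a2b2, a2b3, a3b1, a3b2, a3b3)).
have monof : {mono f : x y / edge x y}.
  by do 2![case=> [[[|[|[|?]]] ?] | [[|[|[|?]]] ?]] //];
    rewrite /f /= ?edge_irrefl ?edgeE // edge_sym ?edgeE.
apply: (embeds_twin_free _ monof) => x y eqe.
pose o (k : nat) (ltk : k < 3) := Ordinal ltk.
move: (eqe (inl (o 0 isT))) (eqe (inl (o 1 isT))) (eqe (inl (o 2 isT))).
move: (eqe (inr (o 0 isT))) (eqe (inr (o 1 isT))) (eqe (inr (o 2 isT))).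
move: x y {eqe}.
by do 2![case=> [[[|[|[|?]]] ?] | [[|[|[|?]]] ?]] //] => *;
  congr (_ _); apply: val_inj.
Qed.

(** * Three moves on the forbidden subgraphs *)

(** Take for [x] an optimal opening: if Staller's legal reply [y] left some [u] undominated, a third
    move would exist. The bound on [#|G|] provides fuel for three moves. *)
Lemma game_le2 (G : sgraph) : isolate_free G -> 2 < #|G| ->
  game_total_domination_number G <= 2 ->
  exists x : G, forall y, (exists2 u, edge y u & ~~ edge x u) ->
    forall u, edge x u || edge y u.
Proof.
rewrite /game_total_domination_number => isoG.
case cardG: #|G| => [|[|[|n]]] // _.
have [x0 _] : exists x : G, x \in G by apply/card_gt0P; rewrite cardG.
have Nlegal0 : legal set0 x0.
  have /existsP[u x0u] := forallP isoG x0; apply/legalP; exists u => //.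
  by rewrite in_totally_dominated; apply/exists_inP=> -[s]; rewrite inE.
have domE (z u : G) : (u \in totally_dominated (z |: set0)) = edge z u.
  rewrite in_totally_dominatedU1 in_totally_dominated.
  rewrite [X in _ || X](_ : _ = false) ?orbF //.
  by apply/exists_inP=> -[s]; rewrite inE.
have [x _ ->] := moves_left_attained n.+2 true Nlegal0.
rewrite ltnS => le1; exists x => y [u0 yu0 xu0] u.
have legal_y : legal (x |: set0) y by apply/legalP; exists u0; rewrite ?domE.
have := leq_trans (moves_left_staller n.+1 legal_y) le1.
rewrite ltnS; apply: contraTT; rewrite negb_or => /andP[xu yu].
have /existsP[z uz] := forallP isoG u.
have legal_z : legal (y |: (x |: set0)) z.
  apply/legalP; exists u; first by rewrite edge_sym.
  by rewrite in_totally_dominatedU1 domE negb_or yu.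
by have [? _ ->] := moves_left_attained n true legal_z.
Qed.

(** The pair [v], [w] is total dominating, so perfection limits the game on the copy of [H] to two
    moves, and [game_le2] transfers back to [H]. *)
Lemma game_perfect_isomorphic (G H : sgraph) (A : {set G}) (v w : H) :
    game_perfect G -> isomorphic H (induced A) -> isolate_free H -> 2 < #|H| ->
    (forall u, edge v u || edge w u) ->
  exists x : H, forall y, (exists2 u, edge y u & ~~ edge x u) ->
    forall u, edge x u || edge y u.
Proof.
move=> perfG [f bijf monof] isoH cardH domvw.
have [g fK gK] := bijf.
have isoA : isolate_free (induced A).
  apply/forallP=> x; have /existsP[y] := forallP isoH (g x).
  by rewrite -monof gK => xy; apply/existsP; exists (f y).
have A0 : A != set0 by apply/set0Pn; exists (val (f v)); apply: valP.
have domfvw : total_dominating [set f v; f w].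
  apply/forallP=> x; apply/exists_inP; have := domvw (g x).
  rewrite -!monof gK => /orP[vx | wx]; [exists (f v) | exists (f w)];
    by rewrite ?inE ?eqxx ?orbT // edge_sym.
have game2 : game_total_domination_number (induced A) <= 2.
  rewrite perfG // (leq_trans (total_domination_number_le domfvw)) //.
  by rewrite cards2; case: (_ != _).
have cardA : 2 < #|induced A| by rewrite -(bij_eq_card bijf).
have [x Hx] := game_le2 isoA cardA game2.
exists (g x) => y [u yu xu] t; have := Hx (f y) _ (f t).
rewrite -[x in edge x (f t)]gK !monof; apply; exists (f u); rewrite ?monof //.
by rewrite -[x]gK monof.
Qed.

Lemma game_perfect_P4_free (G : sgraph) :
  game_perfect G -> induced_free (path_graph 4) G.
Proof.
move=> perfG [A isoA].
pose o (k : nat) (ltk : k < 4) : path_graph 4 := Ordinal ltk.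
have isoP : isolate_free (path_graph 4).
  apply/forallP=> -[[|[|[|[|?]]]] ?] //; apply/existsP.
  - by exists (o 1 isT).
  - by exists (o 0 isT).
  - by exists (o 1 isT).
  - by exists (o 2 isT).
have domP u : edge (o 1 isT) u || edge (o 2 isT) u.
  by case: u => [[|[|[|[|?]]]] ?].
have cardP : 2 < #|path_graph 4| by rewrite card_ord.
have [x] := game_perfect_isomorphic perfG isoA isoP cardP domP.
(* For each opening: Staller's reply, a vertex it newly dominates, and a vertex still missed. *)
case: x => [[|[|[|[|?]]]] ?] // Hx.
- by have := Hx (o 1 isT) (ex_intro2 _ _ (o 0 isT) isT isT) (o 3 isT).
- by have := Hx (o 0 isT) (ex_intro2 _ _ (o 1 isT) isT isT) (o 3 isT).
- by have := Hx (o 3 isT) (ex_intro2 _ _ (o 2 isT) isT isT) (o 0 isT).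
- by have := Hx (o 2 isT) (ex_intro2 _ _ (o 3 isT) isT isT) (o 0 isT).
Qed.

Lemma game_perfect_co2P3_free (G : sgraph) :
  game_perfect G -> induced_free co2P3 G.
Proof.
move=> perfG [A isoA].
pose o (k : nat) (ltk : k < 3) : path_graph 3 := Ordinal ltk.
pose l k ltk : co2P3 := inl (o k ltk); pose r k ltk : co2P3 := inr (o k ltk).
have isoP : isolate_free co2P3.
  apply/forallP=> -[i | i]; apply/existsP; first by exists (r 0 isT).
  by exists (l 0 isT).
have domP u : edge (l 0 isT) u || edge (r 0 isT) u.
  by case: u => i; rewrite /= ?orbT.
have cardP : 2 < #|co2P3| by rewrite card_sum !card_ord.
have [x] := game_perfect_isomorphic perfG isoA isoP cardP domP.
case: x => [[[|[|[|?]]] ?] | [[|[|[|?]]] ?]] // Hx.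
(* Staller replies at an end of the same [P_3], whose midpoint has neighbors only in the other copy
   and stays undominated. *)
- by have := Hx (l 2 isT) (ex_intro2 _ _ (l 0 isT) isT isT) (l 1 isT).
- by have := Hx (l 0 isT) (ex_intro2 _ _ (l 2 isT) isT isT) (l 1 isT).
- by have := Hx (l 0 isT) (ex_intro2 _ _ (l 2 isT) isT isT) (l 1 isT).
- by have := Hx (r 2 isT) (ex_intro2 _ _ (r 0 isT) isT isT) (r 1 isT).
- by have := Hx (r 0 isT) (ex_intro2 _ _ (r 2 isT) isT isT) (r 1 isT).
- by have := Hx (r 0 isT) (ex_intro2 _ _ (r 2 isT) isT isT) (r 1 isT).
Qed.

Theorem proposition5p2 (G : sgraph) (G_nonempty : 0 < #|G|)
    (G_isolate_free : isolate_free G) :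
  game_perfect G <->
  induced_free (path_graph 4) G /\
  induced_free (complement (disjoint_union (path_graph 3) (path_graph 3))) G.
Proof.
split=> [perfG | [/induced_freeP noP4 /induced_freeP no2P3] A _ isoA].
  by split; [apply: game_perfect_P4_free | apply: game_perfect_co2P3_free].
(* Both exclusions pass to induced subgraphs, so Dominator's strategy works on each isolate-free
   one. *)
apply: game_total_domination_numberE => //.
  by apply: p4_free_embeds; apply: contra_not noP4; apply: embeds_induced.
by apply: co2p3_free_embeds; apply: contra_not no2P3; apply: embeds_induced.
Qed.
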